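(* Consider the contextual bilateral trade problem in the one-bit feedback model. There exists a profit-maximizing algorithm that achieves regret $O(d\,6^d\log T)$ and enforces per-round budget balance.
   Context: Contextual bilateral trade: Let $\mathbb{B}=\{w\in\mathbb{R}^d:\|w\|_2\le 1\}$. There are two fixed vectors $s,b\in\mathbb{B}$ unknown to the learner. At each time $t=1,\dots,T$, the learner observes a context $x_t\in\mathbb{B}$ (the contexts and $s,b$ are fixed in advance by an oblivious adversary; this is an instance), and posts a price $p_t$ to the seller and $q_t$ to the buyer. Valuations: $s_t=\langle s,x_t\rangle$, $b_t=\langle b,x_t\rangle$; the trade happens iff $s_t\le p_t$ and $q_t\le b_t$. Profit: $\mathrm{Profit}_t(p_t,q_t)=(q_t-p_t)\,\mathbb{1}\{s_t\le p_t\}\mathbb{1}\{q_t\le b_t\}$. One-bit feedback: after each round the learner observes only $\mathbb{1}\{s_t\le p_t\}\cdot\mathbb{1}\{q_t\le b_t\}$. Regret of a (possibly randomized) algorithm $\mathcal{A}$: $R_T(\mathcal{A})=\sup_{\mathcal{I}}\mathbb{E}\big[\sum_{t=1}^T (b_t-s_t)_+-\sum_{t=1}^T\mathrm{Profit}_t(p_t,q_t)\big]$, expectation over the algorithm's randomness. Per-round budget balance: $p_t\le q_t$ for every $t$. The $O(\cdot)$ hides absolute constants independent of $d$ and $T$. *)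

(* Defs.v *)
From HB Require Import structures.
From mathcomp Require Import all_boot all_order all_algebra.
From mathcomp Require Import all_classical all_reals all_analysis.
Set Implicit Arguments. Unset Strict Implicit. Unset Printing Implicit Defensive.
Import Order.TTheory GRing.Theory Num.Theory.
Local Open Scope ring_scope.

Section Defs.
Variables (R : realType) (d : nat).

Definition dotp (u v : 'rV[R]_d) : R := \sum_(i < d) u 0 i * v 0 i.

Definition in_ball (w : 'rV[R]_d) : Prop := Num.sqrt (dotp w w) <= 1.

(* A (possibly randomized) algorithm with internal randomness omega : Omega.
   At round t (0-indexed) it sees the contexts x_0..x_t (a sequence of length
   t+1) and the one-bit feedbacks of rounds 0..t-1 (a sequence of length t)
   and posts (p_t, q_t) = (seller price, buyer price).  Causality / the
   one-bit feedback model are enforced by the type of the inputs. *)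
Definition algorithm (Omega : Type) :=
  Omega -> seq 'rV[R]_d -> seq bool -> R * R.

Variable Omega : Type.
Variable A : algorithm Omega.
Variables (s b : 'rV[R]_d) (x : nat -> 'rV[R]_d) (w : Omega).

Definition seller_val (t : nat) : R := dotp s (x t).
Definition buyer_val (t : nat) : R := dotp b (x t).

Fixpoint history (t : nat) : seq bool :=
  match t with
  | 0 => [::]
  | t'.+1 =>
      let h := history t' in
      let pq := A w (mkseq x t'.+1) h in
      rcons h ((seller_val t' <= pq.1) && (pq.2 <= buyer_val t'))
  end.

Definition prices (t : nat) : R * R := A w (mkseq x t.+1) (history t).

Definition indic (c : bool) : R := if c then 1 else 0.

Definition profit (t : nat) : R :=
  ((prices t).2 - (prices t).1) *
  (indic (seller_val t <= (prices t).1) * indic ((prices t).2 <= buyer_val t)).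

Definition total_profit (T : nat) : R := \sum_(t < T) profit t.

End Defs.

Definition total_gft (R : realType) (d : nat) (s b : 'rV[R]_d)
  (x : nat -> 'rV[R]_d) (T : nat) : R :=
  \sum_(t < T) Num.max (buyer_val b x t - seller_val s x t) 0.

(* Main.v *)
Require Import Defs.
From HB Require Import structures.
From mathcomp Require Import all_boot all_order all_algebra.
From mathcomp Require Import all_classical all_reals all_analysis.
From mathcomp Require Import ring lra zify.
Import Order.TTheory GRing.Theory Num.Theory.
Local Open Scope ring_scope.

(** The trader keeps convex sets of candidates for [s] and [b]; each round they
    give intervals [[ls, us]] and [[lb, ub]] of possible valuations.  If both are
    shorter than 1/T, the safe prices lose O(1/T).  If the intervals overlap
    little, one side can be priced so that it surely accepts, and the single bit
    then tells about the other side, whose interval loses at least a third of its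
    width.  Otherwise a random common price [p = q] is posted: it is accepted with
    probability at least half the gain from trade, up to 1/T, and any acceptance
    cuts a third off one of the two intervals.  Hence the expected loss of a round
    is at most twice the expected number of cuts.

    Cuts are counted with the logarithm of the number of grid cells (of mesh
    about 1/(dT)) close to the candidate set.  By convexity, the cells discarded by
    a cut contain the image of all cells under the homothety of ratio 1/6 centred
    at an extreme point, so a cut lowers the potential by at least 6^-d, and the
    potential is initially O(d log (dT)).  For T < d the bound is trivial. *)

(** * Inner products, the unit box and support functions *)

Section Geometry.
Local Open Scope classical_set_scope.
Context {R : realType} {d : nat}.
Implicit Types (x c u v : 'rV[R]_d) (C : set 'rV[R]_d).

Definition box : set 'rV[R]_d := [set c | forall i, `|c 0 i| <= 1].

Definition convex_rV C :=
  forall u v (t : R), 0 <= t <= 1 -> C u -> C v -> C (t *: u + (1 - t) *: v).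

Definition support_fun C x : R := sup [set dotp c x | c in C].

Lemma dotpDl u v x : dotp (u + v) x = dotp u x + dotp v x.
Proof. by rewrite /dotp -big_split; apply: eq_bigr => i _; rewrite mxE mulrDl. Qed.

Lemma dotpZl (a : R) u x : dotp (a *: u) x = a * dotp u x.
Proof. by rewrite /dotp mulr_sumr; apply: eq_bigr => i _; rewrite mxE mulrA. Qed.

Lemma dotpNr u x : dotp u (- x) = - dotp u x.
Proof. by rewrite /dotp -sumrN; apply: eq_bigr => i _; rewrite mxE mulrN. Qed.

(** Each coordinate costs at most [e] since [|x_i| <= 1]; this is where the factor [d] of [eps]
    comes from. *)
Lemma dotp_sup_norm x u v (e : R) : box x ->
  (forall i, `|u 0 i - v 0 i| <= e) -> dotp u x <= dotp v x + d%:R * e.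
Proof.
move=> bx uv; rewrite -lerBlDl /dotp -sumrB.
have -> : d%:R * e = \sum_(i < d) e by rewrite sumr_const card_ord mulr_natl.
apply: ler_sum => i _; rewrite -mulrBl.
apply: le_trans (ler_norm _) _; rewrite normrM -[e]mulr1.
by apply: ler_pM.
Qed.

Lemma box_opp x : box x -> box (- x).
Proof. by move=> bx i; rewrite mxE normrN. Qed.

Lemma box_convex : convex_rV box.
Proof.
move=> u v t t01 bu bv i; rewrite !mxE.
have := bu i; have := bv i; rewrite !ler_norml => /andP[? ?] /andP[? ?].
by apply/andP; split; nra.
Qed.

Lemma in_ball_dotp u : in_ball u -> dotp u u <= 1.
Proof.
rewrite /in_ball => h.
have u0 : 0 <= dotp u u by apply: sumr_ge0 => i _; rewrite -expr2 sqr_ge0.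
by rewrite -(sqr_sqrtr u0) expr_le1 // sqrtr_ge0.
Qed.

Lemma in_ball_box u : in_ball u -> box u.
Proof.
move=> /in_ball_dotp u1 i; rewrite -(@expr_le1 _ 2) // real_normK ?num_real//.
apply: le_trans u1.
rewrite /dotp (bigD1 i) //= -expr2 lerDl.
by apply: sumr_ge0 => j _; rewrite -expr2 sqr_ge0.
Qed.

Lemma in_ball_dotp_le u x : in_ball u -> in_ball x -> `|dotp u x| <= 1.
Proof.
have key (y z : 'rV[R]_d) : in_ball y -> in_ball z -> dotp y z <= 1.
  move=> /in_ball_dotp y1 /in_ball_dotp z1.
  (* Nonnegativity of the squares [(y_i - z_i)^2] does the work of Cauchy-Schwarz on the unit
     ball. *)
  have : 2 * dotp y z <= dotp y y + dotp z z.
    rewrite /dotp mulr_sumr -big_split /=; apply: ler_sum => i _.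
    by have := sqr_ge0 (y 0 i - z 0 i); nra.
  by lra.
move=> bu bx; rewrite ler_norml key // andbT lerNl -dotpNr key //.
by rewrite /in_ball /dotp; under eq_bigr do rewrite !mxE mulrNN.
Qed.

Lemma has_sup_dotp C x : C `<=` box -> box x -> C !=set0 ->
  has_sup [set dotp c x | c in C].
Proof.
move=> Cb bx [c Cc]; split; first by exists (dotp c x), c.
exists (d%:R * 1) => _ [e Ce <-].
have -> : d%:R * 1 = dotp 0 x + d%:R * 1 :> R.
  by rewrite /dotp big1 ?add0r// => i _; rewrite mxE mul0r.
by apply: dotp_sup_norm => // i; rewrite mxE subr0; exact: Cb.
Qed.

Lemma le_support C x c : C `<=` box -> box x -> C c -> dotp c x <= support_fun C x.
Proof.
move=> Cb bx Cc; apply: sup_upper_bound; last by exists c.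
by apply: has_sup_dotp => //; exists c.
Qed.

Lemma ge_support C x c : C `<=` box -> box x -> C c -> - support_fun C (- x) <= dotp c x.
Proof.
move=> Cb bx Cc; rewrite lerNl -dotpNr.
by apply: le_support => //; exact: box_opp.
Qed.

(** No closedness is assumed of [C], so an almost-maximizer stands in for a maximizer. *)
Lemma support_near C x (e : R) : 0 < e -> C `<=` box -> box x -> C !=set0 ->
  exists2 c, C c & support_fun C x - e < dotp c x.
Proof.
move=> e0 Cb bx C0; have [_ [c Cc <-] h] := sup_adherent e0 (has_sup_dotp _ _ Cb bx C0).
by exists c.
Qed.

(** * Grid cells near a convex set, and the potential *)

Section Grid.
Variables (M : nat) (dl : R).
Hypotheses (dl0 : 0 < dl) (dl2 : dl <= 1 / 2) (Mdl : M%:R * dl = 4).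

Definition grid_point (k : {ffun 'I_d -> 'I_M}) : 'rV[R]_d :=
  \row_i (- 2 + dl * (k i)%:R).

(** The tolerance exceeds the mesh [dl] on purpose: the homothety of ratio 1/6 brings a cell within
    [dl / 3] of [C] and rounding adds [dl], so the result is again a cell of [C]. *)
Definition cells C : {set {ffun 'I_d -> 'I_M}} :=
  [set k | `[< exists2 c, C c & forall i, `|grid_point k 0 i - c 0 i| <= 2 * dl >]].

Lemma cellsP C k : reflect
  (exists2 c, C c & forall i, `|grid_point k 0 i - c 0 i| <= 2 * dl)
  (k \in cells C).
Proof. by rewrite inE; exact: asboolP. Qed.

Lemma cells_sub C C' : C `<=` C' -> cells C \subset cells C'.
Proof.
move=> CC; apply/fintype.subsetP => k /cellsP [c Cc h]; apply/cellsP; exists c => //.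
exact: CC.
Qed.

Lemma grid_index (y : R) : -2 <= y < 2 -> (Num.trunc ((y + 2) / dl) < M)%N.
Proof.
have [dlP dlH MdlE] := And3 dl0 dl2 Mdl.
move=> /andP[y1 y2]; rewrite truncn_lt_nat; last by rewrite divr_ge0 ?(ltW dl0)//; lra.
by rewrite ltr_pdivrMr //; lra.
Qed.

Lemma grid_round (y : 'rV[R]_d) : (forall i, -2 <= y 0 i < 2) ->
  exists2 k : {ffun 'I_d -> 'I_M},
    (forall i, k i = Num.trunc ((y 0 i + 2) / dl) :> nat) &
    forall i, `|grid_point k 0 i - y 0 i| <= dl.
Proof.
have [dlP dlH MdlE] := And3 dl0 dl2 Mdl.
move=> hy; exists [ffun i => Ordinal (grid_index _ (hy i))] => i; rewrite ?ffunE //.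
rewrite mxE ffunE /=.
have h0 : 0 <= (y 0 i + 2) / dl by rewrite divr_ge0 ?(ltW dl0)//; have := hy i; lra.
have /andP[h1 h2] := truncn_itv h0.
set n := Num.trunc _ in h1 h2 *.
move: h1 h2; rewrite ler_pdivlMr // ltr_pdivrMr // -natr1 ler_norml => h1 h2.
by apply/andP; split; lra.
Qed.

Lemma cells_gt0 C c : C c -> C `<=` box -> (0 < #|cells C|)%N.
Proof.
have [dlP dlH MdlE] := And3 dl0 dl2 Mdl.
move=> Cc Cb; have bc := Cb _ Cc.
have [i|k _ kc] := @grid_round c.
  by have := bc i; rewrite ler_norml; lra.
apply/card_gt0P; exists k; apply/cellsP; exists c => // i.
by apply: le_trans (kc i) _; lra.
Qed.

(* The homothety of ratio 1/6 centred at a point [z] that almost maximizes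
   [dotp _ x] sends the cells of [C] to cells missed by the cut [C'];
   rounding to the grid, a cell is determined by its image and by its
   coordinates modulo 6. *)
Lemma cells_cut C C' x (m : R) :
  C `<=` box -> convex_rV C -> C !=set0 -> box x -> C' `<=` C ->
  (forall c, C' c -> dotp c x <= m) ->
  let w := support_fun C x + support_fun C (- x) in
  32 * d%:R * dl <= w -> (0 < d)%N ->
  m <= support_fun C x - w / 3 ->
  (#|cells C| <= 6 ^ d * (#|cells C| - #|cells C'|))%N.
Proof.
have [dlP dlH MdlE] := And3 dl0 dl2 Mdl.
move=> Cb Cc C0 bx CC Cm w hw hd hm.
have [z Cz zx] := support_near C x (2 * dl) ltac:(lra) Cb bx C0.
pose y k := (1/6 : R) *: grid_point k + (1 - 1/6) *: z.
have yE k i : y k 0 i = (grid_point k 0 i + 5 * z 0 i) / 6 by rewrite !mxE; lra.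
have yb k i : k \in cells C -> -2 <= y k 0 i < 2.
  move=> /cellsP [c hc /(_ i)]; rewrite yE.
  have := Cb _ Cz i; have := Cb _ hc i.
  rewrite !ler_norml => /andP[? ?] /andP[? ?] /andP[? ?]; lra.
have img k : exists j : {ffun 'I_d -> 'I_M}, k \in cells C ->
    (forall i, j i = Num.trunc ((y k 0 i + 2) / dl) :> nat) /\
    j \in cells C :\: cells C'.
  have [kC|] := boolP (k \in cells C); last by exists k.
  have [i|j jE jy] := grid_round (y k); first exact: yb.
  exists j => _; split => //.
  have /cellsP [c hc kc] := kC.
  have yc i : `|y k 0 i - ((1/6 : R) *: c + (1 - 1/6) *: z) 0 i| <= dl / 3.
    rewrite yE !mxE; have := kc i; rewrite !mxE !ler_norml => /andP[? ?].
    by apply/andP; split; lra.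
  rewrite inE; apply/andP; split; last first.
    apply/cellsP; exists ((1/6 : R) *: c + (1 - 1/6) *: z); first by apply: Cc => //; lra.
    move=> i; have := jy i; have := yc i.
    by rewrite !ler_norml => /andP[? ?] /andP[? ?]; apply/andP; split; lra.
  (* Let [D = d * dl] and [u] be the support of [C]. The image has value at least [u - w / 6] and
     [C'] stays below [u - w / 3], up to errors totalling [5 * D]. Hence [w <= 30 * D], against
     [32 * D <= w]. *)
  apply/negP => /cellsP [c' hc' jc'].
  have h1 := dotp_sup_norm _ _ _ _ bx jc'.
  have h2 : dotp (y k) x <= dotp (grid_point j) x + d%:R * dl.
    by apply: dotp_sup_norm => // i; rewrite distrC; exact: jy.
  have h3 : dotp c x <= dotp (grid_point k) x + d%:R * (2 * dl).
    by apply: dotp_sup_norm => // i; rewrite distrC; exact: kc.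
  have h4 := ge_support _ _ _ Cb bx hc.
  have h5 := Cm _ hc'.
  move: h2; rewrite /y dotpDl !dotpZl => h2.
  have d1 : dl <= d%:R * dl by rewrite ler_peMl ?ler1n// ltW.
  rewrite /w in hw hm *; set D := d%:R * dl in h1 h2 h3 d1 *.
  have hw' : 32 * D <= support_fun C x + support_fun C (- x) by rewrite /D mulrA.
  have E : d%:R * (2 * dl) = 2 * D by rewrite /D; ring.
  by rewrite E in h1 h3; lra.
have [f fP] := choice img.
pose g k := (f k, [ffun i => inord (k i %% 6)] : {ffun 'I_d -> 'I_6}).
have ginj : {in cells C &, injective g}.
  move=> k k' kC k'C [fk rk]; apply/ffunP => i; apply: val_inj => /=.
  have [fE _] := fP _ kC; have [fE' _] := fP _ k'C.
  have /ffunP/(_ i) := rk; rewrite !ffunE => /(congr1 val).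
  rewrite /= !inordK ?ltn_pmod// => rki.
  have : Num.trunc ((y k 0 i + 2) / dl) = Num.trunc ((y k' 0 i + 2) / dl).
    by rewrite -fE -fE' fk.
  have p0 k0 : k0 \in cells C -> 0 <= (y k0 0 i + 2) / dl.
    by move=> h; rewrite divr_ge0 ?(ltW dl0)//; have := yb k0 i h; lra.
  have /andP[a1 a2] := truncn_itv (p0 _ kC).
  have /andP[] := truncn_itv (p0 _ k'C).
  move=> + + tE; rewrite -tE => b1 b2.
  move: a1 a2 b1 b2; set n := Num.trunc _ => a1 a2 b1 b2.
  move: a1 a2 b1 b2; rewrite !ler_pdivlMr // !ltr_pdivrMr // !yE !mxE -natr1.
  move=> a1 a2 b1 b2.
  (* Equal floors put the images within [dl], so the indices differ by less than 6; equal residues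
     modulo 6 then force equality. *)
  have l1 : dl * (k i)%:R < dl * (k' i + 6)%:R by rewrite natrD; lra.
  have l2 : dl * (k' i)%:R < dl * (k i + 6)%:R by rewrite natrD; lra.
  move: l1 l2; rewrite !ltr_pM2l // !ltr_nat => l1 l2.
  by move: l1 l2 rki; move: (nat_of_ord (k i)) (nat_of_ord (k' i)) => a b; lia.
rewrite -[leqLHS](card_in_imset ginj).
have /subset_leq_card : g @: cells C \subset
    finset.setX (cells C :\: cells C') finset.setT.
  apply/fintype.subsetP => _ /imsetP[k kC ->].
  rewrite finset.in_setX finset.in_setT andbT /=.
  by have [] := fP _ kC.
rewrite cardsX cardsT card_ffun !card_ord mulnC => h; apply: leq_trans h _.
rewrite leq_mul2l cardsD leq_sub2l ?orbT//.
by rewrite (finset.setIidPr (cells_sub _ _ CC)).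
Qed.

Definition potential C : R := ln #|cells C|%:R.

Lemma potential_le C C' c : C' c -> C' `<=` C -> C `<=` box ->
  potential C' <= potential C.
Proof.
move=> C'c CC Cb; have C'b := subset_trans CC Cb.
have := cells_gt0 _ _ C'c C'b; have := cells_gt0 _ _ (CC _ C'c) Cb => h h'.
rewrite ler_ln ?posrE ?ltr0n// ler_nat; apply: subset_leq_card.
exact: cells_sub.
Qed.

Lemma potential_ge0 C c : C c -> C `<=` box -> 0 <= potential C.
Proof.
by move=> Cc Cb; apply: ln_ge0; rewrite ler1n; apply: cells_gt0 Cc Cb.
Qed.

Lemma potential_box : (0 < M)%N -> potential box <= d%:R * ln M%:R.
Proof.
move=> M0; have b0 : box 0 by move=> i; rewrite mxE normr0.
have h := cells_gt0 _ _ b0 (@subset_refl _ _).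
rewrite mulr_natl -lnXn ?ltr0n// ler_ln ?posrE ?exprn_gt0 ?ltr0n//.
rewrite -natrX ler_nat; apply: leq_trans (max_card _) _.
by rewrite card_ffun !card_ord.
Qed.

(** By [cells_cut] the ratio of the cell counts is at most [1 - 6^-d], and [ln y <= y - 1] turns
    this into a drop of the logarithm. The point [c] keeps the count of [C'] positive. *)
Lemma potential_cut C C' x (m : R) c :
  C `<=` box -> convex_rV C -> box x -> C' `<=` C -> C' c ->
  (forall c, C' c -> dotp c x <= m) ->
  let w := support_fun C x + support_fun C (- x) in
  32 * d%:R * dl <= w -> (0 < d)%N ->
  m <= support_fun C x - w / 3 ->
  1 <= 6 ^+ d * (potential C - potential C').
Proof.
move=> Cb Cc bx CC C'c Cm w hw hd hm.
have C0 : C !=set0 by exists c; exact: CC.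
have h := cells_cut _ _ _ _ Cb Cc C0 bx CC Cm hw hd hm.
have N'0 := cells_gt0 _ _ C'c (subset_trans CC Cb).
have NN := subset_leq_card (cells_sub _ _ CC).
rewrite /potential; move: h N'0 NN; move: #|cells C| #|cells C'| => N N' h N'0 NN.
have N0 : (0 < N)%N by lia.
have hR : N%:R <= 6 ^+ d * (N%:R - N'%:R) :> R.
  by rewrite -natrB// -natrX -natrM ler_nat.
have NR : 0 < N%:R :> R by rewrite ltr0n.
have N'R : 0 < N'%:R :> R by rewrite ltr0n.
have e6 : 0 < 6 ^+ d :> R by rewrite exprn_gt0.
have -> : ln N'%:R = ln N%:R + ln (1 + (N'%:R / N%:R - 1)) :> R.
  by rewrite -lnM ?posrE ?subrKC ?divr_gt0// mulrCA divff ?mulr1// gt_eqF.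
have := @le_ln1Dx R (N'%:R / N%:R - 1).
rewrite ltrBrDr addNr divr_gt0 // => /(_ isT) hl.
have : 6 ^+ d * (1 - N'%:R / N%:R) <= 6 ^+ d * - ln (1 + (N'%:R / N%:R - 1)) :> R.
  by rewrite ler_pM2l //; lra.
have : 1 <= 6 ^+ d * (1 - N'%:R / N%:R) :> R.
  rewrite -(ler_pM2r NR) mul1r -mulrA mulrBl mul1r divfK ?gt_eqF//.
by move=> a b; apply: le_trans a (le_trans b _); rewrite ler_pM2l //; lra.
Qed.

End Grid.
End Geometry.

(** * Prices, updates and the analysis of one round *)

Section Round.
Local Open Scope classical_set_scope.
Context {R : realType} {d : nat}.
Implicit Types (x s b : 'rV[R]_d) (pq : R * R).

Definition knowledge := (set 'rV[R]_d * set 'rV[R]_d)%type.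
Implicit Type S : knowledge.

(** The seller surely accepts [us], the buyer [lb]. A midpoint price would bisect the probed
    interval; the maximum or minimum keeps [p <= q], and the branch test still guarantees a cut of a
    third. *)
Definition quote (eps : R) S x (pi : R) : R * R :=
  let us := support_fun S.1 x in let ls := - support_fun S.1 (- x) in
  let ub := support_fun S.2 x in let lb := - support_fun S.2 (- x) in
  let ws := us - ls in let wb := ub - lb in
  if (ws < 3 * eps) && (wb < 3 * eps) then (us, Num.max lb us)
  else if (eps <= wb) && (us <= ub - wb / 3) then (us, Num.max us ((lb + ub) / 2))
  else if (eps <= ws) && (ls + ws / 3 <= lb) then (Num.min lb ((ls + us) / 2), lb)
  else (pi, pi).

Definition accepts s b x pq := (dotp s x <= pq.1) && (pq.2 <= dotp b x).

(* A refusal is informative only if one side is known to accept its price. *)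
Definition learn S x pq (c : bool) : knowledge :=
  ([set s | [/\ S.1 s, c -> dotp s x <= pq.1 &
     ~~ c -> (forall b, S.2 b -> pq.2 <= dotp b x) -> pq.1 <= dotp s x]],
   [set b | [/\ S.2 b, c -> pq.2 <= dotp b x &
     ~~ c -> (forall s, S.1 s -> dotp s x <= pq.1) -> dotp b x <= pq.2]]).

Definition sound s b S :=
  [/\ S.1 `<=` box /\ S.2 `<=` box, convex_rV S.1 /\ convex_rV S.2, S.1 s & S.2 b].

Lemma quote_le eps S x pi : (quote eps S x pi).1 <= (quote eps S x pi).2.
Proof.
rewrite /quote /=; case: ifP => _ /=; [|case: ifP => _ /=; [|case: ifP => _ //=]].
- by rewrite le_max lexx orbT.
- by rewrite le_max lexx.
- by rewrite ge_min lexx.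
Qed.

(** Each added constraint is a closed half-space containing the true vector, so truth and convexity
    both survive. *)
Lemma learn_sound s b S x pq :
  sound s b S -> sound s b (learn S x pq (accepts s b x pq)).
Proof.
rewrite /accepts; move=> [[S1 S2] [c1 c2] Ss Sb]; split; rewrite /learn /=.
- by split=> c []; [move=> /S1|move=> /S2].
- split=> u v t t01 [u1 u2 u3] [v1 v2 v3].
  + split; first exact: c1.
      by move=> h; rewrite dotpDl !dotpZl; have := u2 h; have := v2 h; nra.
    by move=> h h'; rewrite dotpDl !dotpZl; have := u3 h h'; have := v3 h h'; nra.
  + split; first exact: c2.
      by move=> h; rewrite dotpDl !dotpZl; have := u2 h; have := v2 h; nra.
    by move=> h h'; rewrite dotpDl !dotpZl; have := u3 h h'; have := v3 h h'; nra.
- split=> //; first by move=> /andP[].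
  by move=> + /(_ _ Sb) h; rewrite h andbT -ltNge => /ltW.
- split=> //; first by move=> /andP[].
  by move=> + /(_ _ Ss) h; rewrite h /= -ltNge => /ltW.
Qed.

Variables (M : nat) (dl : R).
Hypotheses (dl0 : 0 < dl) (dl2 : dl <= 1 / 2) (Mdl : M%:R * dl = 4).
Hypothesis d0 : (0 < d)%N.
(** The interval width from which [potential_cut] applies. *)
Let eps := 32 * d%:R * dl.

Definition total_potential S : R := potential M dl S.1 + potential M dl S.2.

Definition cuts_third (C C' : set 'rV[R]_d) x :=
  let u := support_fun C x in let l := - support_fun C (- x) in
  eps <= u - l /\
  ((exists2 m, m <= u - (u - l) / 3 & forall c, C' c -> dotp c x <= m) \/
   (exists2 m, l + (u - l) / 3 <= m & forall c, C' c -> m <= dotp c x)).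

(** A lower cut in direction [x] is an upper cut in direction [- x], for the same width. *)
Lemma potential_cuts_third (C C' : set 'rV[R]_d) x c :
  C `<=` box -> convex_rV C -> box x -> C' `<=` C -> C' c -> cuts_third C C' x ->
  1 <= 6 ^+ d * (potential M dl C - potential M dl C').
Proof.
rewrite /cuts_third /eps => Cb Cc bx CC C'c [hw [] [m hm hc]].
- by apply: (potential_cut _ _ dl0 dl2 Mdl _ _ x m c) => //; lra.
- apply: (potential_cut _ _ dl0 dl2 Mdl _ _ (- x) (- m) c) => //;
    rewrite ?opprK; try lra; first exact: box_opp.
  by move=> e /hc; rewrite dotpNr lerN2.
Qed.

Section OneRound.
Variables (s b x : 'rV[R]_d) (S : knowledge).
Hypotheses (bx : box x) (hS : sound s b S).
Let us := support_fun S.1 x.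
Let ls := - support_fun S.1 (- x).
Let ub := support_fun S.2 x.
Let lb := - support_fun S.2 (- x).

Let next pq := learn S x pq (accepts s b x pq).

Lemma potential_learn pq :
  potential M dl (next pq).1 <= potential M dl S.1 /\
  potential M dl (next pq).2 <= potential M dl S.2.
Proof.
have [_ _ S1 S2] := learn_sound _ _ _ x pq hS.
have [[b1 b2] _ _ _] := hS.
split; [apply: potential_le dl0 dl2 Mdl _ _ s S1 _ b1|
        apply: potential_le dl0 dl2 Mdl _ _ b S2 _ b2];
  by move=> c [].
Qed.

Lemma total_potential_learn pq : total_potential (next pq) <= total_potential S.
Proof. by have [? ?] := potential_learn pq; exact: lerD. Qed.

Lemma total_potential_cut pq :
  cuts_third S.1 (next pq).1 x \/ cuts_third S.2 (next pq).2 x ->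
  1 <= 6 ^+ d * (total_potential S - total_potential (next pq)).
Proof.
have e6 : 0 < 6 ^+ d :> R by rewrite exprn_gt0.
have [_ _ S1 S2] := learn_sound _ _ _ x pq hS.
have [[b1 b2] [c1 c2] _ _] := hS.
have i1 : (next pq).1 `<=` S.1 by move=> c [].
have i2 : (next pq).2 `<=` S.2 by move=> c [].
have [p1 p2] := potential_learn pq.
case=> [/(potential_cuts_third _ _ x s b1 c1 bx i1 S1)|
        /(potential_cuts_third _ _ x b b2 c2 bx i2 S2)] h;
  by apply: le_trans h _; rewrite ler_pM2l // /total_potential; lra.
Qed.

Definition round_regret pq : R :=
  Num.max (dotp b x - dotp s x) 0 -
  (pq.2 - pq.1) * (Defs.indic R (dotp s x <= pq.1) * Defs.indic R (pq.2 <= dotp b x)).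

Lemma round_regret_le pq : pq.1 <= pq.2 ->
  round_regret pq <= Num.max (dotp b x - dotp s x) 0.
Proof.
move=> h; rewrite /round_regret gerBl; apply: mulr_ge0; first by rewrite subr_ge0.
by rewrite /Defs.indic; apply: mulr_ge0; case: ifP.
Qed.

Hypotheses (bs : `|dotp s x| <= 1) (bb : `|dotp b x| <= 1).

(* The last branch of [quote] is reached only if the two ranges of values
   overlap so much that any accepted common price cuts a third of a range
   of width at least [eps]. *)
Lemma quote_cases :
  (forall pi, round_regret (quote eps S x pi) <=
     2 * (6 ^+ d * (total_potential S - total_potential (next (quote eps S x pi))))
       + 6 * eps) \/
  (forall pi, quote eps S x pi = (pi, pi) /\
     (dotp s x <= pi <= dotp b x ->
      1 <= 6 ^+ d * (total_potential S - total_potential (next (pi, pi))))).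
Proof.
have e6 : 0 < 6 ^+ d :> R by rewrite exprn_gt0.
have eps0 : 0 <= eps by rewrite /eps !mulr_ge0// ltW.
have [[b1 b2] [c1 c2] S1 S2] := hS.
have h1 := le_support _ _ _ b1 bx S1; have h2 := ge_support _ _ _ b1 bx S1.
have h3 := le_support _ _ _ b2 bx S2; have h4 := ge_support _ _ _ b2 bx S2.
rewrite -/us -/ls -/ub -/lb in h1 h2 h3 h4.
move: bs bb; rewrite !ler_norml => /andP[bs1 bs2] /andP[bb1 bb2].
have gft2 : Num.max (dotp b x - dotp s x) 0 <= 2 by rewrite ge_max; apply/andP; split; lra.
have drop0 pq : 0 <= 6 ^+ d * (total_potential S - total_potential (next pq)).
  by apply: mulr_ge0; [exact: ltW|rewrite subr_ge0; exact: total_potential_learn].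
(* A round loses at most 2, hence the factor 2 before the potential drop. *)
have cut pi : 1 <= 6 ^+ d * (total_potential S - total_potential (next (quote eps S x pi))) ->
  round_regret (quote eps S x pi) <=
     2 * (6 ^+ d * (total_potential S - total_potential (next (quote eps S x pi))))
       + 6 * eps.
  by move=> h; apply: le_trans (round_regret_le _ (quote_le _ _ _ _)) _; lra.
case: (boolP ((us - ls < 3 * eps) && (ub - lb < 3 * eps))) => [/andP[w1 w2]|Nw].
  left => pi; apply: le_trans (_ : 6 * eps <= _); last first.
    by rewrite lerDr; have := drop0 (quote eps S x pi); lra.
  have -> : quote eps S x pi = (us, Num.max lb us).
    by rewrite /quote -/us -/ls -/ub -/lb w1 w2.
  (* If [us <= lb], both sides surely accept and only the two widths are lost; otherwise the gain
     from trade itself is below their sum. *)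
  have [lu|ul] := leP us lb.
    rewrite /round_regret /= h1 h4 /Defs.indic !mulr1 (max_idPl _); lra.
  apply: le_trans (round_regret_le _ _) _ => //=.
  by rewrite ge_max; apply/andP; split; lra.
case: (boolP ((eps <= ub - lb) && (us <= ub - (ub - lb) / 3))) => [/andP[w1 w2]|Nb].
  left => pi; apply: cut.
  have -> : quote eps S x pi = (us, Num.max us ((lb + ub) / 2)).
    by rewrite /quote -/us -/ls -/ub -/lb (negbTE Nw) w1 w2.
  set pq := (us, _); apply: total_potential_cut; rewrite /cuts_third -/us -/ls -/ub -/lb.
  have [c|c] := boolP (accepts s b x pq).
    right; split=> //; right; exists pq.2.
      by rewrite /pq /= le_max; apply/orP; right; lra.
    by rewrite /next c => e [_ /(_ isT)].
  right; split=> //; left; exists pq.2.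
    by rewrite /pq /= ge_max w2 /=; lra.
  rewrite /next (negbTE c) => e [_ _ /(_ isT)]; apply => f Sf.
  exact: le_support.
case: (boolP ((eps <= us - ls) && (ls + (us - ls) / 3 <= lb))) => [/andP[w1 w2]|Ns].
  left => pi; apply: cut.
  have -> : quote eps S x pi = (Num.min lb ((ls + us) / 2), lb).
    by rewrite /quote -/us -/ls -/ub -/lb (negbTE Nw) (negbTE Nb) w1 w2.
  set pq := (_, lb); apply: total_potential_cut; rewrite /cuts_third -/us -/ls -/ub -/lb.
  have [c|c] := boolP (accepts s b x pq).
    left; split=> //; left; exists pq.1.
      by rewrite /pq /= ge_min; apply/orP; right; lra.
    by rewrite /next c => e [_ /(_ isT)].
  left; split=> //; right; exists pq.1.
    by rewrite /pq /= le_min w2 /=; lra.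
  rewrite /next (negbTE c) => e [_ _ /(_ isT)]; apply => f Sf.
  exact: ge_support.
right => pi; split.
  by rewrite /quote -/us -/ls -/ub -/lb (negbTE Nw) (negbTE Nb) (negbTE Ns).
move=> /andP[p1 p2]; apply: total_potential_cut; rewrite /cuts_third -/us -/ls -/ub -/lb.
have c : accepts s b x (pi, pi) by rewrite /accepts /= p1 p2.
suff [[w pu]|[w pl]] : (eps <= us - ls /\ pi <= us - (us - ls) / 3) \/
        (eps <= ub - lb /\ lb + (ub - lb) / 3 <= pi).
- by left; split=> //; left; exists pi => //; rewrite /next c => e [_ /(_ isT)].
- by right; split=> //; right; exists pi => //; rewrite /next c => e [_ /(_ isT)].
move: Nw Nb Ns; rewrite !negb_and -!leNgt -!ltNge => Nw Nb Ns.
have [ws|ws] := leP eps (us - ls); have [wb|wb] := leP eps (ub - lb).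
- have {}Nb : ub - (ub - lb) / 3 < us by case/orP: Nb => //; lra.
  have {}Ns : lb < ls + (us - ls) / 3 by case/orP: Ns => //; lra.
  (* Averaging [Nb] and [Ns] gives [lb + (ub - lb) / 3 < us - (us - ls) / 3], so [pi] satisfies one
     of the two alternatives. *)
  have [?|?] := leP pi (us - (us - ls) / 3); [by left|right; split => //; lra].
(* The buyer's interval is shorter than [eps], so the seller's has width at least [3 * eps]; then
   [pi <= ub < lb + eps] lies in its lower two thirds. *)
- have {}Ns : lb < ls + (us - ls) / 3 by case/orP: Ns => //; lra.
  by left; split=> //; case/orP: Nw => ?; lra.
- have {}Nb : ub - (ub - lb) / 3 < us by case/orP: Nb => //; lra.
  by right; split=> //; case/orP: Nw => ?; lra.
- by case/orP: Nw; lra.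
Qed.

End OneRound.
End Round.

(** * The uniform law on an initial segment of [nat] *)

Section UniformNat.
Local Open Scope classical_set_scope.
Context {R : realType}.
Variable n : nat.
(** On [nat] every function is measurable, so a single random index can carry all the randomness.
    Taking [n.+1] atoms keeps the normalization nonzero. *)
Definition uniform_nat : set nat -> \bar R :=
  mscale (n.+1%:R^-1)%:nng (msum (fun i : nat => dirac i : {measure set nat -> \bar R}) n.+1).
HB.instance Definition _ := Measure.on uniform_nat.
Lemma uniform_nat_setT : uniform_nat [set: nat] = 1%E.
Proof.
rewrite /uniform_nat /mscale /= /msum /=; under eq_bigr do rewrite diracT.
by rewrite sumEFin -EFinM sumr_const card_ord mulVf.
Qed.
HB.instance Definition _ := Measure_isProbability.Build _ _ _ uniform_nat uniform_nat_setT.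

Lemma integral_uniform_nat (f : nat -> R) : (forall i, 0 <= f i) ->
  (\int[uniform_nat]_i (f i)%:E = (n.+1%:R^-1 * \sum_(i < n.+1) f i)%:E)%E.
Proof.
move=> f0.
rewrite ge0_integral_mscale //=; last by move=> i _; rewrite lee_fin.
rewrite ge0_integral_measure_sum //=; last by move=> i _; rewrite lee_fin.
rewrite EFinM -sumEFin; congr (_ * _)%E; apply: eq_bigr => i _.
by rewrite integral_dirac // diracT mul1e.
Qed.
End UniformNat.

(** * Counting grid prices in an interval *)

Lemma card_ord_itv (i j K : nat) : (j <= K)%N ->
  #|[set k : 'I_K | (i <= k < j)%N]%SET| = (j - i)%N.
Proof.
move=> jK; rewrite cardsE -sum1_card.
rewrite -(big_mkord (fun k => i <= k < j)%N (fun=> 1%N)).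
rewrite -[RHS]muln1 -sum_nat_const_nat.
rewrite (big_nat_widen _ _ _ _ _ jK) (big_nat_widenl _ _ _ _ _ (leq0n i)) /=.
by apply: eq_bigl => k; rewrite andbC.
Qed.

Section PriceGrid.
Context {R : realType}.

Definition price_grid K (k : nat) : R := -1 + 2 * k%:R / K%:R.

(** The spacing is [2 / K], and rounding at the two ends loses at most one grid point in total. *)
Lemma price_grid_count K (a c : R) : (0 < K)%N -> -1 <= a -> c <= 1 ->
  K%:R * (c - a) <=
  2 * (#|[set k : 'I_K | (a <= price_grid K k <= c)%R]%SET|%:R + 1).
Proof.
move=> K0 a1 c1; have KR : 0 < K%:R :> R by rewrite ltr0n.
have [ca|ac] := ltP c a.
  apply: le_trans (_ : 0 <= _); last by rewrite mulr_ge0// addr_ge0.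
  by rewrite pmulr_rle0 //; lra.
pose y1 := (a + 1) * K%:R / 2; pose y2 := (c + 1) * K%:R / 2.
have y10 : 0 <= y1 by rewrite /y1 !mulr_ge0//; lra.
have y20 : 0 <= y2 by rewrite /y2 !mulr_ge0//; lra.
have y2K : y2 <= K%:R by rewrite /y2; nra.
(* The cap by [K] matters when [c = 1]: there [y2 = K], and index [K] is off the grid. *)
pose i := (Num.trunc y1).+1; pose j := minn K (Num.trunc y2).+1.
have iy : i%:R <= y1 + 1 by rewrite /i -natr1 lerD2r; have /andP[] := truncn_itv y10.
have iy' : y1 < i%:R by exact: truncnS_gt.
have jy : y2 <= j%:R.
  by rewrite /j /minn; case: ifP => // _; apply: ltW; exact: truncnS_gt.
have : (j - i <= #|[set k : 'I_K | (a <= price_grid K k <= c)%R]%SET|)%N.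
  rewrite -(card_ord_itv i j K) ?geq_minl//; apply: subset_leq_card.
  apply/fintype.subsetP => k; rewrite !inE => /andP[ik kj].
  have ik' : y1 < k%:R by apply: lt_le_trans iy' _; rewrite ler_nat.
  have kj' : k%:R <= y2.
    rewrite -truncn_ge_nat //; move: kj; rewrite /j leq_min ltnS => /andP[_].
    by [].
  move: ik' kj'; rewrite /price_grid /y1 /y2 => ik' kj'; apply/andP; split.
    by rewrite -lerBlDl ler_pdivlMr //; lra.
  by rewrite -lerBrDl ler_pdivrMr //; lra.
set N := #|_|; rewrite -(ler_nat R) => hN.
have : j%:R - i%:R <= (j - i)%:R :> R.
  have [ij|ji] := leqP i j; first by rewrite natrB.
  by apply: le_trans (ler0n _ _); rewrite subr_le0 ler_nat ltnW.
have -> : K%:R * (c - a) = 2 * (y2 - y1) by rewrite /y1 /y2; lra.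
lra.
Qed.

End PriceGrid.

(** * Regret of one round summed over all grid prices *)

Section RoundSum.
Local Open Scope classical_set_scope.
Context {R : realType} {d : nat}.
Variables (M : nat) (dl : R).
Hypotheses (dl0 : 0 < dl) (dl2 : dl <= 1 / 2) (Mdl : M%:R * dl = 4).
Hypothesis d0 : (0 < d)%N.
Let eps := 32 * d%:R * dl.
Variables (s b x : 'rV[R]_d).
Hypotheses (bs : in_ball s) (bb : in_ball b) (bx : in_ball x).

(* A random common price is accepted with probability about half the gain
   from trade, and an accepted price pays for the loss with potential. *)
Lemma round_sum K S : (0 < K)%N -> K%:R * (6 * eps) <= 2 -> sound s b S ->
  \sum_(k < K) round_regret s b x (quote eps S x (price_grid K k)) <=
  2 * (6 ^+ d * \sum_(k < K) (total_potential M dl S -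
    total_potential M dl
      (let pq := quote eps S x (price_grid K k) in
       learn S x pq (accepts s b x pq)))) + 2.
Proof.
move=> K0 Keps hS; have xb := in_ball_box _ bx.
have sx := in_ball_dotp_le _ _ bs bx; have bx1 := in_ball_dotp_le _ _ bb bx.
have e6 : 0 < 6 ^+ d :> R by rewrite exprn_gt0.
rewrite mulr_sumr mulr_sumr.
have [h|h] := quote_cases M dl dl0 dl2 Mdl d0 s b x S xb hS sx bx1.
  apply: le_trans (_ : _ <= \sum_(k < K) (2 * (6 ^+ d * (total_potential M dl S -
    total_potential M dl (let pq := quote eps S x (price_grid K k) in
       learn S x pq (accepts s b x pq)))) + 6 * eps)) _.
    by apply: ler_sum => k _; exact: h.
  by rewrite big_split /= lerD2l sumr_const card_ord -[_ *+ K]mulr_natl.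
set D := Num.max (dotp b x - dotp s x) 0.
apply: le_trans (_ : _ <= \sum_(k < K) D) _.
  by apply: ler_sum => k _; apply: round_regret_le; exact: quote_le.
rewrite sumr_const card_ord -[D *+ K]mulr_natl.
move: sx bx1; rewrite !ler_norml => /andP[s1 s2] /andP[b1 b2].
(* The prices counted are those that both sides accept; each of them pays for a cut. *)
have cnt := price_grid_count K (dotp s x) (dotp b x) K0 s1 b2.
set N := #|_| in cnt.
have KD : K%:R * D <= 2 * N%:R + 2.
  rewrite /D; have [_|_] := leP (dotp b x - dotp s x) 0; last by lra.
  by rewrite mulr0 addr_ge0// mulr_ge0.
apply: le_trans KD _; rewrite lerD2r /N cardsE -sum1_card natr_sum mulr_sumr big_mkcond /=.
apply: ler_sum => k _; have [-> hk] := h (price_grid K k).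
case: ifP => [kin|_]; first by rewrite mulr1; have := hk kin; lra.
apply: mulr_ge0 => //; apply: mulr_ge0; first exact: ltW.
by rewrite subr_ge0; exact: total_potential_learn.
Qed.

End RoundSum.

(** * The algorithm and its play against an instance *)

Section Trader.
Local Open Scope classical_set_scope.
Context {R : realType} {d : nat}.
Implicit Types (x : nat -> 'rV[R]_d) (s b : 'rV[R]_d) (pr : nat -> R).
Variable eps : R.

(** The state is rebuilt from contexts and recorded bits, which are all that the algorithm sees. In
    actual play the defaults [0] and [false] are never reached. *)
Fixpoint knowledge_at pr (xs : seq 'rV[R]_d) (fb : seq bool) t : @knowledge R d :=
  if t is t'.+1 then
    let S := knowledge_at pr xs fb t' in
    learn S (nth 0 xs t') (quote eps S (nth 0 xs t') (pr t')) (nth false fb t')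
  else (box, box).

Definition trader {Omega : Type} (pr : Omega -> nat -> R) : algorithm R d Omega :=
  fun w xs fb => quote eps (knowledge_at (pr w) xs fb (size fb))
                   (nth 0 xs (size fb)) (pr w (size fb)).

(** The same recursion driven by the true answers, free of the history. *)
Fixpoint run s b x pr t : @knowledge R d :=
  if t is t'.+1 then
    let S := run s b x pr t' in
    let pq := quote eps S (x t') (pr t') in
    learn S (x t') pq (accepts s b (x t') pq)
  else (box, box).

(** This allows the draw of round [t] to vary while the knowledge before it stays fixed. *)
Lemma run_eq s b x pr pr' t : (forall i, (i < t)%N -> pr i = pr' i) ->
  run s b x pr t = run s b x pr' t.
Proof.
elim: t => //= t IH h; rewrite h // IH // => i it; apply: h.
exact: ltn_trans it _.
Qed.

Lemma run_sound s b x pr t : box s -> box b -> sound s b (run s b x pr t).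
Proof.
move=> bs bb; elim: t => [|t IH] /=; last exact: learn_sound.
by split => //; split => //; exact: box_convex.
Qed.

Section Play.
Context {Omega : Type}.
Variables (pr : Omega -> nat -> R) (s b : 'rV[R]_d) (x : nat -> 'rV[R]_d) (w : Omega).
Let A := trader pr.

Lemma size_history t : size (history A s b x w t) = t.
Proof. by elim: t => //= t IH; rewrite size_rcons IH. Qed.

Lemma nth_history t i : (i < t)%N ->
  nth false (history A s b x w t) i = accepts s b (x i) (prices A s b x w i).
Proof.
elim: t => //= t IH; rewrite ltnS leq_eqVlt nth_rcons size_history.
by case: ltngtP => //= [it _|-> _]; [exact: IH|].
Qed.

(** Strong induction is used because the recorded bits depend on all earlier prices. *)
Lemma prices_trader t :
  prices A s b x w t = quote eps (run s b x (pr w) t) (x t) (pr w t).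
Proof.
elim/ltn_ind: t => t IH; rewrite /prices {1}/A /trader size_history nth_mkseq //.
suff H j : (j <= t)%N -> knowledge_at (pr w) (mkseq x t.+1) (history A s b x w t) j =
    run s b x (pr w) j by rewrite H.
elim: j => //= j IHj jt; rewrite IHj ?(ltnW jt)// nth_mkseq; last exact: ltnW.
by rewrite nth_history // IH.
Qed.

Lemma trader_balance t : (prices A s b x w t).1 <= (prices A s b x w t).2.
Proof. by rewrite prices_trader; exact: quote_le. Qed.

Lemma total_profit_ge0 T : 0 <= total_profit A s b x w T.
Proof.
apply: sumr_ge0 => t _; rewrite /profit mulr_ge0 ?subr_ge0 ?trader_balance//.
by rewrite /Defs.indic mulr_ge0//; case: ifP.
Qed.

Lemma regret_trader T : total_gft s b x T - total_profit A s b x w T =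
  \sum_(t < T) round_regret s b (x t) (quote eps (run s b x (pr w) t) (x t) (pr w t)).
Proof.
rewrite /total_gft /total_profit -sumrB; apply: eq_bigr => t _.
by rewrite -prices_trader.
Qed.

End Play.
End Trader.

(** * Redrawing a single price *)

Section Resample.
Context {R : realType} {T K : nat}.
Implicit Types (g : {ffun 'I_T -> 'I_K}).

Definition resample (t : 'I_T) g (k : 'I_K) : {ffun 'I_T -> 'I_K} :=
  [ffun i => if i == t then k else g i].

(** Exchanging coordinate [t] of [g] with [k] is an involution on pairs [(g, k)]. This finite
    identity replaces conditioning on the other draws. *)
Lemma sum_resample (t : 'I_T) (F : {ffun 'I_T -> 'I_K} -> R) :
  \sum_g \sum_(k < K) F (resample t g k) = K%:R * \sum_g F g.
Proof.
rewrite pair_big /=.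
rewrite (reindex_inj (h := fun p => (resample t p.1 p.2, p.1 t))) /=; last first.
  apply: (can_inj (g := fun p => (resample t p.1 p.2, p.1 t))) => -[g k] /=.
  rewrite ffunE eqxx; congr (_, _); apply/ffunP => i; rewrite !ffunE.
  by case: eqP => // ->.
transitivity (\sum_(p : {ffun 'I_T -> 'I_K} * 'I_K) F p.1).
  apply: eq_bigr => -[g k] _ /=; congr F; apply/ffunP => i; rewrite !ffunE.
  by case: eqP => // ->.
rewrite -(pair_big xpredT xpredT (fun g _ => F g)) /= mulr_sumr.
by apply: eq_bigr => g _; rewrite sumr_const card_ord mulr_natl.
Qed.

Definition draws g (t : nat) : R := oapp (fun i => price_grid K (g i)) 0 (insub t).

Lemma drawsE g (t : 'I_T) : draws g t = price_grid K (g t).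
Proof. by rewrite /draws valK. Qed.

Lemma draws_resample g (t : 'I_T) k i : (i < t)%N ->
  draws (resample t g k) i = draws g i.
Proof.
move=> it; rewrite /draws; case: insubP => //= j _ ji; rewrite ffunE.
by case: eqP it => // <-; rewrite ji ltnn.
Qed.

End Resample.

(** * Averaging over the draws and telescoping over the rounds *)

Section ExpectedRegret.
Context {R : realType} {d : nat}.
Variables (M T : nat) (dl : R).
Hypotheses (dl0 : 0 < dl) (dl2 : dl <= 1 / 2) (Mdl : M%:R * dl = 4).
Hypothesis d0 : (0 < d)%N.
Let eps := 32 * d%:R * dl.
Variables (s b : 'rV[R]_d) (x : nat -> 'rV[R]_d).
Hypotheses (bs : in_ball s) (bb : in_ball b) (bx : forall t, in_ball (x t)).
Hypotheses (T0 : (0 < T)%N) (Teps : T%:R * (6 * eps) <= 2).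

Let st (g : {ffun 'I_T -> 'I_T}) t := run eps s b x (draws g) t.

(** This is [round_sum] with [K = T], for each fixed choice of the other draws; its additive 2 is
    spread as [2 / T] over the values of draw [t]. *)
Lemma sum_round (t : 'I_T) :
  \sum_(g : {ffun 'I_T -> 'I_T})
    round_regret s b (x t) (quote eps (st g t) (x t) (draws g t)) <=
  \sum_(g : {ffun 'I_T -> 'I_T}) (2 * (6 ^+ d * (total_potential M dl (st g t) -
     total_potential M dl (st g t.+1))) + 2 / T%:R).
Proof.
have TR : 0 < T%:R :> R by rewrite ltr0n.
have c2 : \sum_(t < T) (2 / T%:R) = 2 :> R.
  by rewrite sumr_const card_ord -[LHS]mulr_natr divfK ?gt_eqF.
rewrite -(ler_pM2l TR) -!(sum_resample t); apply: ler_sum => g _.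
have stE k : st (resample t g k) t = st g t.
  by apply: run_eq => i it; exact: draws_resample.
under eq_bigr do rewrite drawsE ffunE eqxx stE.
apply: le_trans (round_sum M dl dl0 dl2 Mdl d0 s b (x t) bs bb (bx t) T (st g t) T0 Teps _) _.
  by apply: run_sound; exact: in_ball_box.
rewrite [leRHS]big_split /= c2 lerD2r.
rewrite !mulr_sumr; apply: ler_sum => k _.
have -> : st (resample t g k) t.+1 =
    let pq := quote eps (st g t) (x t) (price_grid T k) in
    learn (st g t) (x t) pq (accepts s b (x t) pq).
  by rewrite /st /= -/(st _ _) stE drawsE ffunE eqxx.
by rewrite stE.
Qed.

Lemma sum_regret :
  \sum_(g : {ffun 'I_T -> 'I_T}) \sum_(t < T)
    round_regret s b (x t) (quote eps (st g t) (x t) (draws g t)) <=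
  #|{ffun 'I_T -> 'I_T}|%:R * (2 * (6 ^+ d * (2 * (d%:R * ln M%:R))) + 2).
Proof.
have TR : 0 < T%:R :> R by rewrite ltr0n.
have c2 : \sum_(t < T) (2 / T%:R) = 2 :> R.
  by rewrite sumr_const card_ord -[LHS]mulr_natr divfK ?gt_eqF.
have e6 : 0 < 6 ^+ d :> R by rewrite exprn_gt0.
rewrite exchange_big /=.
apply: le_trans (ler_sum (G := fun t : 'I_T => _) _ (fun t _ => sum_round t)) _.
rewrite exchange_big /=.
apply: le_trans (_ : _ <= \sum_(g : {ffun 'I_T -> 'I_T})
    (2 * (6 ^+ d * (2 * (d%:R * ln M%:R))) + 2)) _; last first.
  by rewrite sumr_const -[leLHS]mulr_natl.
apply: ler_sum => g _.
rewrite big_split /= c2 lerD2r -!mulr_sumr !ler_pM2l//.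
have M0 : (0 < M)%N.
  rewrite lt0n; apply/eqP => M0; move: Mdl; rewrite M0 mul0r => /eqP.
  by rewrite eq_sym pnatr_eq0.
(* The drops telescope from the potential of two boxes down to a nonnegative one. *)
have -> n : \sum_(t < n) (total_potential M dl (st g t) - total_potential M dl (st g t.+1)) =
    total_potential M dl (st g 0) - total_potential M dl (st g n).
  elim: n => [|n IH]; first by rewrite big_ord0 subrr.
  by rewrite big_ord_recr /= IH; lra.
have [[b1 b2] _ S1 S2] := run_sound eps s b x (draws g) T (in_ball_box _ bs) (in_ball_box _ bb).
have := potential_ge0 _ _ dl0 dl2 Mdl _ _ S1 b1.
have := potential_ge0 _ _ dl0 dl2 Mdl _ _ S2 b2.
have := @potential_box R d _ _ dl0 dl2 Mdl M0.
by rewrite /total_potential /st /=; lra.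
Qed.

End ExpectedRegret.

(** * Logarithmic estimates and the choice of parameters *)

Lemma half_le_ln (R : realType) T : (2 <= T)%N -> 1 / 2 <= ln T%:R :> R.
Proof.
move=> T2; have h : ln 2 <= ln T%:R :> R by rewrite ler_ln ?posrE ?ltr0n ?ler_nat//; lia.
have := @le_ln1Dx R (- (1 / 2)).
have -> : 1 + - (1 / 2) = 2^-1 :> R by lra.
by rewrite lnV ?posrE //; lra.
Qed.

(** From [384 <= 2^9 <= T^9] and [d <= T] follows [384 * d * T <= T^11]. *)
Lemma ln_grid_le (R : realType) d T : (0 < d <= T)%N -> (2 <= T)%N ->
  ln (384 * d * T)%:R <= 11 * ln T%:R :> R.
Proof.
move=> /andP[d0 dT] T2; have T0 : (0 < T)%N by lia.
rewrite mulr_natl -lnXn ?ltr0n// ler_ln ?posrE ?exprn_gt0 ?ltr0n ?muln_gt0 ?d0 ?T0//.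
rewrite -natrX ler_nat -[11%N]/((9 + 1).+1) expnSr leq_mul2r expnD expn1; apply/orP; right.
by apply: leq_mul => //; apply: leq_trans (_ : 2 ^ 9 <= _)%N => //; rewrite leq_exp2r.
Qed.

Theorem theorem5p6 (R : realType) :
  exists C : R, 0 < C /\
  forall (d T : nat), (1 <= d)%N -> (2 <= T)%N ->
  exists (dO : measure_display) (Omega : measurableType dO)
         (P : probability Omega R) (A : algorithm R d Omega),
    (* measurability of the algorithm in its internal randomness *)
    (forall xs fb, measurable_fun setT (fun w => (A w xs fb).1) /\
                   measurable_fun setT (fun w => (A w xs fb).2)) /\
    (forall (s b : 'rV[R]_d) (x : nat -> 'rV[R]_d),
       in_ball s -> in_ball b -> (forall t, in_ball (x t)) ->
       (* per-round budget balance *)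
       (forall w t, ((prices A s b x w t).1 <= (prices A s b x w t).2)) /\
       (* expected regret bound *)
       (((total_gft s b x T)%:E
          - (\int[P]_w (total_profit A s b x w T)%:E))%E
         <= (C * d%:R * 6 ^+ d * ln T%:R)%:E)%E).
Proof.
(* The main case needs [4 * 11 = 44], plus 4 to absorb the additive [2 <= 4 * ln T]; 100 leaves
   room. *)
exists 100; split => // d T d1 T2.
have T0 : (0 < T)%N by lia.
have dR : 1 <= d%:R :> R by rewrite ler1n.
have TR : 2 <= T%:R :> R by rewrite ler_nat.
have dn0 : d%:R != 0 :> R by rewrite pnatr_eq0 -lt0n.
have Tn0 : T%:R != 0 :> R by rewrite pnatr_eq0 -lt0n.
(* These values give [M * dl = 4] and [eps = 1 / (3 * T)], so that [6 * eps = 2 / T]. *)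
pose M := (384 * d * T)%N; pose dl : R := (96 * d%:R * T%:R)^-1.
have dl0 : 0 < dl by rewrite invr_gt0 !mulr_gt0 ?ltr0n.
have dl2 : dl <= 1 / 2.
  rewrite div1r lef_pV2 ?posrE ?mulr_gt0 ?ltr0n//.
  by rewrite -!natrM ler_nat; nia.
have Mdl : M%:R * dl = 4 by rewrite /M /dl !natrM; field; rewrite Tn0 dn0.
pose eps := 32 * d%:R * dl.
have Teps : T%:R * (6 * eps) <= 2.
  by rewrite /eps /dl le_eqVlt; apply/orP; left; apply/eqP; field; rewrite Tn0 dn0.
pose N := #|{ffun 'I_T -> 'I_T}|.
have N0 : (0 < N)%N by rewrite /N card_ffun !card_ord expn_gt0 T0.
(* The index [w] selects one of the [N = T^T] price sequences; indices from [N] on have probability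
   zero under [uniform_nat N.-1]. *)
pose pr (w : nat) : nat -> R :=
  oapp (fun i : 'I_N => draws (enum_val i)) (fun=> 0) (insub w).
exists default_measure_display, nat, (uniform_nat N.-1), (trader eps pr).
split=> [xs fb|s b x bs bb bx]; first by split.
split=> [w t|]; first exact: trader_balance.
have e6 : 1 <= 6 ^+ d :> R by apply: exprn_ege1; rewrite ler1n.
have lnT := half_le_ln R T T2.
have de : 1 <= d%:R * 6 ^+ d :> R by nra.
rewrite integral_uniform_nat; last by move=> w; exact: total_profit_ge0.
rewrite prednK // -EFinB lee_fin.
(* When [T < d], the loss is at most [2 * T <= 2 * d], and [ln T >= 1 / 2] suffices. *)
have [dT|Td] := leqP d T; last first.
  apply: le_trans (_ : total_gft s b x T <= _).
    by rewrite gerBl mulr_ge0 ?invr_ge0// sumr_ge0// => i _; exact: total_profit_ge0.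
  apply: le_trans (_ : \sum_(t < T) 2 <= _).
    apply: ler_sum => t _; rewrite ge_max /seller_val /buyer_val.
    have := in_ball_dotp_le _ _ bs (bx t); have := in_ball_dotp_le _ _ bb (bx t).
    by rewrite !ler_norml => /andP[? ?] /andP[? ?]; apply/andP; split; lra.
  rewrite sumr_const card_ord -[leLHS]mulr_natr.
  have TdR : T%:R <= d%:R :> R by rewrite ler_nat ltnW.
  have : d%:R <= d%:R * 6 ^+ d :> R by rewrite ler_peMr.
  by set D := d%:R * 6 ^+ d in de *; rewrite -(mulrA 100) -/D => ?; nra.
(* The sum over sample indices becomes a sum over draw functions, with profit written as gain from
   trade minus regret. *)
have sumN : \sum_(i < N) total_profit (trader eps pr) s b x i T =
    N%:R * total_gft s b x T - \sum_(g : {ffun 'I_T -> 'I_T}) \sum_(t < T)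
      round_regret s b (x t) (quote eps (run eps s b x (draws g) t) (x t) (draws g t)).
  rewrite (big_enum_val (A := {: {ffun 'I_T -> 'I_T}})) /=.
  rewrite [N%:R * _]mulr_natl -[in _ *+ N](card_ord N) -sumr_const -sumrB.
  apply: eq_bigr => i _.
  have := regret_trader eps pr s b x i T; rewrite /pr valK /= => <-.
  by rewrite opprB addrC subrK.
have NR : 0 < N%:R :> R by rewrite ltr0n.
rewrite sumN mulrBr mulKf ?gt_eqF// opprB addrC subrK.
have := sum_regret M T dl dl0 dl2 Mdl d1 s b x bs bb bx T0 Teps.
rewrite -/eps => h.
rewrite mulrC ler_pdivrMr //; apply: le_trans h _.
rewrite mulrC ler_pM2r //.
have lnM := ln_grid_le R d T; rewrite d1 dT in lnM; have {}lnM := lnM isT T2.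
rewrite -/M in lnM.
have : d%:R * 6 ^+ d * ln M%:R <= d%:R * 6 ^+ d * (11 * ln T%:R) :> R.
  by rewrite ler_pM2l //; lra.
have : ln T%:R <= d%:R * 6 ^+ d * ln T%:R :> R by rewrite ler_peMl //; lra.
rewrite -!mulrA.
have -> : 6 ^+ d * (2 * (d%:R * ln M%:R)) = 2 * (d%:R * (6 ^+ d * ln M%:R)) :> R by ring.
have -> : d%:R * (6 ^+ d * (11 * ln T%:R)) = 11 * (d%:R * (6 ^+ d * ln T%:R)) :> R by ring.
by lra.
Qed.
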